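(* Let $G$ be a graph of girth at least 6. Then $\Gamma_{pr}(G)=2\Gamma(G)$ if and only if $G$ is isomorphic to $mK_2$ for some $m\geq 1$.
   Context: All graphs are finite, simple and undirected. A set $D\subseteq V(G)$ is dominating if every vertex is in $D$ or adjacent to a vertex of $D$; it is minimal if no proper subset is dominating. $\Gamma(G)$ is the maximum cardinality of a minimal dominating set of $G$. A paired dominating set (PDS) is a dominating set $D$ such that the induced subgraph $G[D]$ has a perfect matching; a PDS is minimal if no proper subset is a PDS. $\Gamma_{pr}(G)$ is the maximum cardinality of a minimal PDS of $G$. The girth of a graph is the length of its shortest cycle (an acyclic graph is regarded as having girth at least 6). $mK_2$ denotes the disjoint union of $m$ copies of $K_2$. *)

(* Defs.v *)
From HB Require Import structures.
From mathcomp Require Import all_boot.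
Set Implicit Arguments.
Unset Strict Implicit.
Unset Printing Implicit Defensive.

Record sgraph := SGraph {
  vertex :> finType;
  adj : rel vertex;
  adj_sym : symmetric adj;
  adj_irrefl : irreflexive adj
}.

Section Domination.
Variable G : sgraph.

Definition dominating (D : {set G}) : bool :=
  [forall v : G, (v \in D) || [exists u in D, adj u v]].

(* Edges of the induced subgraph on D, as two-element sets of vertices;
   u != v follows from irreflexivity of adj. *)
Definition induced_edges (D : {set G}) : {set {set G}} :=
  [set [set u; v] | u in D, v in D & adj u v].

Definition perfect_matching (D : {set G}) (M : {set {set G}}) : bool :=
  [&& M \subset induced_edges D, trivIset M & cover M == D].

Definition paired_dominating (D : {set G}) : bool :=
  dominating D && [exists M : {set {set G}}, perfect_matching D M].

Definition upper_domination : nat :=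
  \max_(D : {set G} | minset dominating D) #|D|.

(* A graph with an isolated vertex has no paired dominating set; the maximum
   over the empty family is then 0. *)
Definition upper_paired_domination : nat :=
  \max_(D : {set G} | minset paired_dominating D) #|D|.

(* ucycle alone also accepts [::] and the closed walks u-v-u along an edge,
   hence the bound on the size. *)
Definition graph_cycle (c : seq G) : Prop := 2 < size c /\ ucycle (@adj G) c.

(* Vacuously true for acyclic graphs. *)
Definition girth_at_least (g : nat) : Prop :=
  forall c : seq G, graph_cycle c -> g <= size c.

End Domination.

Definition isomorphic (G H : sgraph) : Prop :=
  exists2 f : G -> H, bijective f & forall u v : G, adj (f u) (f v) = adj u v.

Definition mK2_adj (m : nat) : rel ('I_m * bool)%type :=
  fun x y => (x.1 == y.1) && (x.2 != y.2).

Lemma mK2_adj_sym m : symmetric (@mK2_adj m).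
Proof. by move=> x y; rewrite /mK2_adj eq_sym (eq_sym x.2). Qed.

Lemma mK2_adj_irrefl m : irreflexive (@mK2_adj m).
Proof. by move=> x; rewrite /mK2_adj !eqxx. Qed.

Definition mK2 (m : nat) : sgraph :=
  SGraph (@mK2_adj_sym m) (@mK2_adj_irrefl m).

(* Main.v *)
Require Import Defs.
From mathcomp Require Import all_boot.
From mathcomp Require Import zify.

(** Let D be a minimal paired dominating set with |D| = 2k and k = Gamma(G); then
    every independent set and every minimal dominating subset of D has at most k
    vertices. Deleting a matched pair destroys domination, so each pair contains a
    vertex with a private neighbour outside D, or an end vertex of G[D]; and no pair
    has private neighbours at both vertices, since a minimal dominating subset of D
    would then have more than k vertices. Choose from each pair the vertex with a
    private neighbour, or else the partner of an end vertex: this transversal is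
    independent because G has no 5-cycle. If some chosen vertex has a private
    neighbour, exchanging vertices produces k + 1 independent vertices. Otherwise
    G[D] is an induced matching, and a vertex outside D, adjacent to at most one
    vertex of each pair, again gives k + 1 independent vertices. Hence D = V(G). *)

Set Implicit Arguments.
Unset Strict Implicit.
Unset Printing Implicit Defensive.

(** * Pairings, external private neighbours and end vertices *)

(** This encodes a perfect matching of [G[D]] as an involution on [D]; adjacency rules out fixed
    points, and values outside [D] are arbitrary. *)
Definition pairing (G : sgraph) (D : {set G}) (p : G -> G) : Prop :=
  forall x, x \in D -> [/\ p x \in D, adj x (p x) & p (p x) = x].

Definition independent (G : sgraph) (I : {set G}) : Prop :=
  {in I &, forall x y, ~~ adj x y}.

Definition private_neighbor (G : sgraph) (D : {set G}) (x w : G) : bool :=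
  (w \notin D) && [forall z in D, adj w z == (z == x)].

Definition has_private (G : sgraph) (D : {set G}) (x : G) : bool :=
  [exists w, private_neighbor D x w].

(** For a matched pair [x], [y] this says that [x] has degree one in [G[D]]. *)
Definition end_vertex (G : sgraph) (D : {set G}) (x y : G) : bool :=
  [forall z in D, adj x z ==> (z == y)].

Lemma adj_neq (G : sgraph) (x y : G) : adj x y -> x != y.
Proof. by apply: contraTneq => ->; rewrite adj_irrefl. Qed.

Lemma girth_no_triangle (G : sgraph) : girth_at_least G 6 ->
  forall x y z : G, adj x y -> adj y z -> ~~ adj x z.
Proof.
move=> g6 x y z xy yz; apply/negP => xz.
suff: graph_cycle [:: x; y; z] by move/g6.
split=> //; rewrite /ucycle /= !inE xy yz adj_sym xz /=.
by rewrite negb_or !adj_neq.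
Qed.

Lemma girth_no_pentagon (G : sgraph) : girth_at_least G 6 ->
  forall a b c d e : G, uniq [:: a; b; c; d; e] ->
  adj a b -> adj b c -> adj c d -> adj d e -> ~~ adj e a.
Proof.
move=> g6 a b c d e U ab bc cd de; apply/negP => ea.
suff: graph_cycle [:: a; b; c; d; e] by move/g6.
by split=> //; rewrite /ucycle U /= ab bc cd de ea.
Qed.

Lemma dominatingP (G : sgraph) (D : {set G}) :
  reflect (forall v, v \notin D -> exists2 u, u \in D & adj u v) (dominating D).
Proof.
apply: (iffP forallP) => [dom v vD | dom v].
  by have := dom v; rewrite (negPf vD) /= => /exists_inP.
by case: (boolP (v \in D)) => //= /dom ?; apply/exists_inP.
Qed.

Lemma dominatingPn (G : sgraph) (D : {set G}) :
  ~~ dominating D -> exists2 v, v \notin D & {in D, forall u, ~~ adj u v}.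
Proof.
rewrite negb_forall => /existsP[v]; rewrite negb_or => /andP[vD].
by rewrite negb_exists_in => /forall_inP; exists v.
Qed.

Lemma paired_dominatingP (G : sgraph) (D : {set G}) :
  reflect (dominating D /\ exists p, pairing D p) (paired_dominating D).
Proof.
apply: (iffP andP) => -[domD].
  move=> /existsP[M /and3P[/subsetP ME tM /eqP covM]]; split=> //.
  pose P x := [pred y | ([set x; y] \in M) && adj x y].
  have uniqP x y z : P x y -> P x z -> y = z.
    move=> /andP[yM xy] /andP[zM xz].
    have E : [set x; y] = [set x; z].
      by rewrite -(def_pblock tM yM (set21 x y)) (def_pblock tM zM (set21 x z)).
    have : y \in [set x; z] by rewrite -E set22.
    by rewrite !inE eq_sym (negPf (adj_neq xy)) => /eqP.
  have exP x : x \in D -> exists y, P x y.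
    rewrite -covM => /bigcupP[B BM xB].
    have /imset2P[u v uD /[!inE] /andP[vD uv] EB] := ME _ BM; subst B.
    move: xB; rewrite !inE => /orP[] /eqP ->; first by exists v; rewrite /= BM.
    by exists u; rewrite /= adj_sym uv setUC BM.
  pose p x := odflt x [pick y | P x y]; exists p.
  have pP x : x \in D -> P x (p x).
    by move=> /exP[y Py]; rewrite /p; case: pickP => [//|/(_ y)]; rewrite Py.
  move=> x xD; have /andP[xM xp] := pP _ xD.
  have pxD : p x \in D by rewrite -covM; apply/bigcupP; exists [set x; p x]; rewrite ?set22.
  split=> //; apply: uniqP (pP _ pxD) _.
  by rewrite /= setUC xM adj_sym.
move=> [p pD]; split=> //; apply/existsP; exists [set [set x; p x] | x in D].
apply/and3P; split.
- apply/subsetP => B /imsetP[x xD ->]; have [pxD xp _] := pD _ xD.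
  by apply/imset2P; exists x (p x); rewrite ?inE ?pxD.
- apply/trivIsetP => _ _ /imsetP[x xD ->] /imsetP[y yD ->].
  have [pxD _ px] := pD _ xD; have [pyD _ py] := pD _ yD.
  apply: contraR; rewrite -setI_eq0 => /set0Pn[z].
  rewrite !inE => /andP[/orP[] /eqP -> /orP[] /eqP E].
  + by rewrite E.
  + by rewrite E py setUC.
  + by rewrite -E px setUC.
  + by rewrite -px -py E.
- rewrite cover_imset; apply/eqP/setP => z; apply/bigcupP/idP.
    by move=> [x xD]; have [pxD _ _] := pD _ xD; rewrite !inE => /orP[] /eqP ->.
  by move=> zD; exists z; rewrite ?set21.
Qed.

(* A maximal independent set is a minimal dominating set. *)
Lemma leq_independent_upper_domination (G : sgraph) (I : {set G}) :
  independent I -> #|I| <= upper_domination G.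
Proof.
pose P (J : {set G}) := [forall x in J, forall y in J, ~~ adj x y].
have PP J : reflect (independent J) (P J).
  apply: (iffP forall_inP) => [h x y xJ yJ | h x xJ]; first exact: (forall_inP (h x xJ)).
  by apply/forall_inP => y yJ; apply: h.
move=> /PP PI; have [J /maxsetP[/PP indJ maxJ] IJ] := maxset_exists PI.
apply: leq_trans (subset_leq_card IJ) _; apply: leq_bigmax_cond.
apply/minsetP; split.
  apply/dominatingP => v vJ; apply/exists_inP; apply: contraNT vJ.
  rewrite negb_exists_in => /forall_inP nv.
  suff <- : v |: J = J by apply: setU11.
  apply: maxJ; last exact: subsetUr.
  apply/PP => x y; rewrite !inE => /orP[/eqP->|xJ] /orP[/eqP->|yJ].
  - by rewrite adj_irrefl.
  - by rewrite adj_sym nv.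
  - exact: nv.
  - exact: indJ.
move=> B /dominatingP domB BJ; apply/eqP; rewrite eqEsubset BJ; apply/subsetP => x xJ.
apply: contraT => /domB[u uB ux].
by rewrite (negPf (indJ _ _ (subsetP BJ _ uB) xJ)) in ux.
Qed.

(** * Counting and choosing transversals of a pairing *)

Lemma pairing_card (G : sgraph) (D B : {set G}) (p : G -> G) : pairing D p ->
  B \subset D -> {in D, forall x, (p x \in B) = (x \notin B)} -> #|D| = 2 * #|B|.
Proof.
move=> pD /subsetP BD trB.
have -> : D = B :|: p @: B.
  apply/setP => x; rewrite inE; apply/idP/orP => [xD|].
    case: (boolP (x \in B)) => xB; [by left | right].
    by apply/imsetP; exists (p x); rewrite ?trB //; have [] := pD _ xD.
  by case=> [/BD //|/imsetP[y /BD yD ->]]; have [] := pD _ yD.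
rewrite cardsU disjoint_setI0 ?cards0 ?subn0.
  rewrite card_in_imset ?mul2n ?addnn // => x y /BD xD /BD yD E.
  by have [_ _ <-] := pD _ xD; have [_ _ <-] := pD _ yD; rewrite E.
rewrite disjoint_sym disjoints_subset; apply/subsetP => _ /imsetP[y yB ->].
by rewrite inE trB ?BD // negbK.
Qed.

Lemma pairing_card_lt (G : sgraph) (D B : {set G}) (p : G -> G) (b : G) : pairing D p ->
  {in D, forall x, (x \in B) || (p x \in B)} ->
  b \in B -> p b \in B -> #|D| < 2 * #|B|.
Proof.
move=> pD covB bB pbB.
(* The image can leave out [b] because [p b] already lies in [B]; this saves the one vertex that
   makes the bound strict. *)
have sub : D \subset B :|: p @: (B :\ b).
  apply/subsetP => x xD; have [pxD _ ppx] := pD _ xD; rewrite inE.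
  case: (boolP (x \in B)) => //= xB; apply/imsetP; exists (p x) => //.
  have := covB _ xD; rewrite (negPf xB) /= !inE => ->; rewrite andbT.
  by apply: contraNneq xB => E; rewrite -ppx E.
have := subset_leq_card sub; have := leq_imset_card p (B :\ b).
rewrite cardsU; have := cardsD1 b B; rewrite bB; lia.
Qed.

Lemma pairing_transversal (G : sgraph) (D : {set G}) (p : G -> G) (Q : pred G) :
  pairing D p -> {in D, forall x, Q x || Q (p x)} ->
  exists A : {set G}, [/\ A \subset D, {in D, forall x, (p x \in A) = (x \notin A)}
    & {in A, forall x, Q x}].
Proof.
move=> pD QD.
(* When both vertices of a pair satisfy [Q], the one of smaller rank is taken; the ranks differ
   because [x] and [p x] are adjacent. *)
exists [set x in D | Q x && (Q (p x) ==> (enum_rank x < enum_rank (p x)))]; split.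
- by apply/subsetP => x /[!inE] /andP[].
- move=> x xD; have [pxD xp ppx] := pD _ xD; have := QD _ xD.
  have : enum_rank x != enum_rank (p x) :> nat.
    by apply: contraTneq xp => /val_inj/enum_rank_inj <-; rewrite adj_irrefl.
  rewrite !inE xD pxD ppx.
  by case: (Q x); case: (Q (p x)) => //=; case: ltngtP.
- by move=> x /[!inE] /and3P[].
Qed.

Lemma private_neighborP (G : sgraph) (D : {set G}) (x w : G) :
  reflect (w \notin D /\ {in D, forall z, adj w z = (z == x)}) (private_neighbor D x w).
Proof.
apply: (iffP andP) => -[wD h]; split=> //.
  by move=> z zD; apply/eqP; apply: (forall_inP h).
by apply/forall_inP => z /h ->.
Qed.

(** * Minimal paired dominating sets in girth at least 6 *)

Section MinimalPairedDominating.

Variables (G : sgraph) (D : {set G}) (p : G -> G).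
Hypotheses (g6 : girth_at_least G 6) (minD : minset (@paired_dominating G) D).
Hypothesis pD : pairing D p.

Lemma minset_paired_dominating : dominating D.
Proof. by have /paired_dominatingP[] := minsetp minD. Qed.

Lemma proper_pairing_not_dominating (E : {set G}) (q : G -> G) :
  E \proper D -> pairing E q -> ~~ dominating E.
Proof.
move=> ED qE; apply/negP => domE.
have PE : paired_dominating E by apply/paired_dominatingP; split=> //; exists q.
by have := ED; rewrite (minsetinf minD PE (proper_sub ED)) properxx.
Qed.

Lemma setD_pair_not_dominating x : x \in D -> ~~ dominating (D :\: [set x; p x]).
Proof.
move=> xD; apply: (@proper_pairing_not_dominating _ p).
  by rewrite properEneq subsetDl andbT; apply: contraTneq xD => <-; rewrite !inE eqxx.
move=> y; rewrite !inE negb_or => /andP[/andP[yx ypx] yD].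
have [pyD yp ppy] := pD yD; have [pxD _ ppx] := pD xD; rewrite pyD andbT negb_or.
split=> //; apply/andP; split.
  by apply: contraNneq ypx => <-; rewrite ppy.
by apply: contraNneq yx => /(congr1 p); rewrite ppx ppy => ->.
Qed.

Lemma has_private_of_pair x y w : w \notin D ->
  {in D, forall z, adj z w -> (z == x) || (z == y)} -> ~~ (adj x w && adj y w) ->
  has_private D x || has_private D y.
Proof.
move=> wD onlyxy nxy; have [u uD uw] := dominatingP _ minset_paired_dominating w wD.
suff Pu : has_private D u by case/orP: (onlyxy _ uD uw) => /eqP <-; rewrite Pu ?orbT.
apply/existsP; exists w; apply/private_neighborP; split=> // z zD.
rewrite adj_sym; apply/idP/eqP => [zw|-> //].
move: nxy; case/orP: (onlyxy _ uD uw) (onlyxy _ zD zw) => /eqP <- /orP[] /eqP <- //.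
  by rewrite uw zw.
by rewrite uw zw.
Qed.

(** Deleting the pair leaves some [w] undominated. If [w] is outside [D], it is adjacent to just one
    vertex of the pair, since two would give a triangle; if [w] is in the pair, its partner is its
    only neighbour in [D]. *)
Lemma has_private_or_end_vertex x : x \in D ->
  [|| has_private D x, has_private D (p x), end_vertex D x (p x) | end_vertex D (p x) x].
Proof.
move=> xD; have [pxD xp ppx] := pD xD.
have [w wE nw] := dominatingPn (setD_pair_not_dominating xD).
have {}nw z : z \in D -> adj z w -> (z == x) || (z == p x).
  by move=> zD; apply: contraTT => nz; apply: nw; rewrite !inE nz.
case: (boolP (w \in D)) => wD; last first.
  rewrite orbA (has_private_of_pair wD nw) //; apply/negP => /andP[xw].
  by rewrite adj_sym; apply/negP/(girth_no_triangle g6 (y := x)) => //; rewrite adj_sym.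
move: wE nw; rewrite !inE wD andbT negbK => /orP[] /eqP -> nw.
  apply/or4P/Or43/forall_inP => z zD; apply/implyP; rewrite adj_sym => zx.
  by have := nw _ zD zx; rewrite (negPf (adj_neq zx)).
apply/or4P/Or44/forall_inP => z zD; apply/implyP; rewrite adj_sym => zx.
by have := nw _ zD zx; rewrite (negPf (adj_neq zx)) orbF.
Qed.

(* Re-pairing a with b frees both partners, so one of them must be needed;
   a vertex needing exactly both of them would close a pentagon. *)
Lemma adj_has_private_partner a b : a \in D -> b \in D -> adj a b -> b != p a ->
  has_private D (p a) || has_private D (p b).
Proof.
move=> aD bD ab bpa.
have [paD apa ppa] := pD aD; have [pbD bpb ppb] := pD bD.
have apb : a != p b by apply: contraNneq bpa => ->; rewrite ppb.
have aNb := adj_neq ab.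
have papb : p a != p b by apply: contraNneq aNb => /(congr1 p); rewrite ppa ppb => ->.
pose q x := if x == a then b else if x == b then a else p x.
have ED : D :\: [set p a; p b] \proper D.
  by rewrite properEneq subsetDl andbT; apply: contraTneq paD => <-; rewrite !inE eqxx.
have /(proper_pairing_not_dominating ED)/dominatingPn[w wE nw] :
    pairing (D :\: [set p a; p b]) q.
  move=> x; rewrite !inE !negb_or => /andP[/andP[xpa xpb] xD]; rewrite /q.
  have [pxD xp ppx] := pD xD.
  have [->|xa] := eqVneq x a.
    by rewrite bD ab bpa adj_neq // eqxx eq_sym (negPf aNb).
  have [->|xb] := eqVneq x b.
    by rewrite aD adj_sym ab apb adj_neq // eqxx.
  have /negPf-> : p x != a by apply: contraNneq xpa => <-; rewrite ppx.
  have /negPf-> : p x != b by apply: contraNneq xpb => <-; rewrite ppx.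
  rewrite pxD xp ppx !andbT; split=> //; apply/andP; split.
    by apply: contraNneq xa => /(congr1 p); rewrite ppx ppa => ->.
  by apply: contraNneq xb => /(congr1 p); rewrite ppx ppb => ->.
have {}nw z : z \in D -> adj z w -> (z == p a) || (z == p b).
  by move=> zD; apply: contraTT => nz; apply: nw; rewrite !inE nz.
(* The deleted vertices [p a] and [p b] stay dominated by [a] and [b], so [w] must lie outside
   [D]. *)
have nend c : c \in D -> p c \in D -> p (p c) = c -> c != p a -> c != p b ->
    w != p c.
  move=> cD pcD ppc ca cb; apply/eqP => Ew.
  have [_ cw _] := pD cD.
  by have := nw _ cD; rewrite Ew (negPf ca) (negPf cb) => /(_ cw).
have wD : w \notin D.
  apply/negP => wD; move: wE; rewrite !inE wD andbT negbK.
  by rewrite !(negPf (nend _ _ _ _ _ _)) // adj_neq.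
apply: (has_private_of_pair wD nw); apply/negP => /andP[paw pbw].
have wN c : c \in D -> (w == c) = false by move=> cD; apply: contraNF wD => /eqP ->.
have := girth_no_pentagon g6 (a := w) (b := p a) (c := a) (d := b) (e := p b).
rewrite pbw adj_sym paw adj_sym apa ab bpb /= !inE !wN // !orbF.
rewrite !negb_or (eq_sym (p a) a) (eq_sym (p a) b) bpa papb apb aNb.
by rewrite !adj_neq // => /(_ isT isT isT isT isT).
Qed.

(** A minimal dominating set [B] inside [D] contains every vertex with a private neighbour, and
    meets every pair because [D] without a pair is not dominating. Containing all of one pair, it
    would have more than half of the vertices of [D]. *)
Lemma not_both_private x : #|D| = 2 * upper_domination G ->
  x \in D -> has_private D x -> ~~ has_private D (p x).
Proof.
move=> cD xD Px; apply/negP => Ppx; have [pxD _ _] := pD xD.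
have [B minB BD] := minset_exists minset_paired_dominating.
have /dominatingP domB := minsetp minB.
have inB y : y \in D -> has_private D y -> y \in B.
  move=> yD /existsP[w /private_neighborP[wD wy]].
  have [|u uB uw] := domB w; first by apply: contraNN wD; apply: (subsetP BD).
  by move: uw; rewrite adj_sym wy ?(subsetP BD) // => /eqP <-.
have : #|D| < 2 * #|B|.
  apply: pairing_card_lt pD _ (inB _ xD Px) (inB _ pxD Ppx) => y yD.
  apply: contraT; rewrite negb_or => /andP[yB pyB].
  apply: contraNT (setD_pair_not_dominating yD) => _.
  have sB : B \subset D :\: [set y; p y].
    apply/subsetP => z zB; rewrite !inE (subsetP BD) // andbT negb_or.
    by apply/andP; split; apply: contraTneq zB => ->.
  apply/dominatingP => v vE; have [|u uB uv] := domB v.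
    by apply: contraNN vE; apply: (subsetP sB).
  by exists u; rewrite // (subsetP sB).
have : #|B| <= upper_domination G by apply: leq_bigmax_cond.
by rewrite cD; lia.
Qed.

(** When [D] has twice the upper domination number of vertices, either alternative leaves [p x]
    without private neighbours for [x] in [D]. *)
Definition dispensable_partner x :=
  has_private D x || ~~ has_private D (p x) && end_vertex D (p x) x.

Hypothesis cD : #|D| = 2 * upper_domination G.

Lemma dispensable_partner_pair x :
  x \in D -> dispensable_partner x || dispensable_partner (p x).
Proof.
move=> xD; have [pxD xp ppx] := pD xD; rewrite /dispensable_partner ppx.
have := has_private_or_end_vertex xD.
by case: (has_private D x); case: (has_private D (p x)); rewrite ?orbT //= orbC.
Qed.

(** * The chosen transversal and the exchange arguments *)

Variable A : {set G}.
Hypothesis AD : A \subset D.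
Hypothesis trA : {in D, forall x, (p x \in A) = (x \notin A)}.
Hypothesis QA : {in A, forall x, dispensable_partner x}.

Lemma transversal_partner_notin x : x \in A -> p x \notin A.
Proof. by move=> xA; rewrite trA ?(subsetP AD) // negbK. Qed.

Lemma transversal_partner_not_private x : x \in A -> ~~ has_private D (p x).
Proof.
move=> xA; have := QA xA => /orP[|/andP[] //].
exact/not_both_private/(subsetP AD).
Qed.

(** An edge inside [A] would join two different pairs, and re-pairing its ends would force a private
    neighbour on one of the partners left out of [A]. *)
Lemma transversal_independent x y : x \in A -> y \in A -> ~~ adj x y.
Proof.
move=> xA yA; apply/negP => xy.
have ypx : y != p x by apply: contraTneq yA => ->; apply: transversal_partner_notin.
have := adj_has_private_partner (subsetP AD _ xA) (subsetP AD _ yA) xy ypx.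
by rewrite !(negPf (transversal_partner_not_private _)).
Qed.

(** [A] is half of [D], so its size is already the upper domination number; an independent copy of
    [A] leaves no room for a further vertex [t]. *)
Lemma transversal_exchange (g : G -> G) (t : G) :
  {in A &, injective g} -> {in A &, forall x y, ~~ adj (g x) (g y)} ->
  {in A, forall x, t != g x} -> {in A, forall x, ~~ adj t (g x)} -> False.
Proof.
move=> injg indg tg ntg.
have : independent (t |: g @: A).
  move=> u v; rewrite !inE => /orP[/eqP->|/imsetP[x xA ->]] /orP[/eqP->|/imsetP[y yA ->]].
  - by rewrite adj_irrefl.
  - exact: ntg.
  - by rewrite adj_sym ntg.
  - exact: indg.
move/leq_independent_upper_domination; rewrite cardsU1 card_in_imset //.
have -> : t \notin g @: A by apply/imsetP => -[x xA E]; have := tg _ xA; rewrite E eqxx.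
by have := pairing_card pD AD trA; rewrite cD; lia.
Qed.

(* Otherwise let t be the partner of such an s: adding t to A, while replacing
   the neighbours of t in A by their private neighbours and the vertices of A
   without private neighbours by their partners, keeps A independent. *)
Lemma transversal_no_private s : s \in A -> ~~ has_private D s.
Proof.
move=> sA; apply/negP => Ps; have sD := subsetP AD _ sA.
have [tD st _] := pD sD; have tA := transversal_partner_notin sA.
set t := p s in tD st tA.
pose w x := odflt x [pick w | private_neighbor D x w].
have wP x : has_private D x -> private_neighbor D x (w x).
  by move=> /existsP[v vP]; rewrite /w; case: pickP => // /(_ v); rewrite vP.
have wD x : has_private D x -> w x \notin D by move/wP/private_neighborP=> [].
have wadj x z : has_private D x -> z \in D -> adj (w x) z = (z == x).
  by move/wP/private_neighborP=> [_ h] /h.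
(* A vertex of [A] without a private neighbour was chosen because its partner is an end vertex. *)
have ladj x z : x \in A -> ~~ has_private D x -> z \in D -> adj (p x) z -> z = x.
  move=> xA nPx zD pxz; have := QA xA; rewrite /dispensable_partner (negPf nPx).
  by move=> /andP[_ /forall_inP/(_ z zD)]; rewrite pxz => /eqP.
pose g x := if has_private D x then (if adj t x then w x else x) else p x.
have inD := subsetP AD.
have pin x : x \in A -> p x \in D by move=> /inD /pD[].
have pnA x y : x \in A -> y \in A -> x != p y.
  by move=> xA yA; apply: contraTneq xA => ->; apply: transversal_partner_notin.
have wN x z : has_private D x -> z \in D -> w x != z.
  by move=> /wD xw; apply: contraTneq => <-.
have gP x : [\/ [/\ has_private D x, adj t x & g x = w x],
    [/\ has_private D x, ~~ adj t x & g x = x] | ~~ has_private D x /\ g x = p x].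
  rewrite /g; case: ifPn => Px; last exact: Or33.
  by case: ifPn => tx; [apply: Or31 | apply: Or32].
have wp x y : has_private D x -> y \in A -> x \in A -> ~~ adj (w x) (p y).
  by move=> Px yA xA; rewrite wadj ?pin // eq_sym pnA.
have wx x y : x \in A -> y \in A -> has_private D x -> adj t x -> ~~ adj t y ->
    ~~ adj (w x) y.
  by move=> xA yA Px tx; rewrite wadj ?inD //; apply: contraNneq => ->.
have px x y : x \in A -> y \in A -> ~~ has_private D x -> has_private D y ->
    ~~ adj (p x) y.
  move=> xA yA nPx Py; apply/negP => /(ladj _ _ xA nPx (inD _ yA)) E.
  by move: nPx; rewrite -E Py.
apply: (@transversal_exchange g t).
- move=> x y xA yA; case: (gP x) => -[Px]; [move=> tx|move=> ntx|] => ->;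
    case: (gP y) => -[Py]; [move=> ty|move=> nty| |move=> ty|move=> nty|
      |move=> ty|move=> nty|] => ->.
  + by move=> E; apply/eqP; rewrite -(wadj y) ?inD // -E wadj ?inD.
  + by move/eqP; rewrite (negPf (wN _ _ _ _)) ?inD.
  + by move/eqP; rewrite (negPf (wN _ _ _ _)) ?pin.
  + by move/esym/eqP; rewrite (negPf (wN _ _ _ _)) ?inD.
  + by [].
  + by move/eqP; rewrite (negPf (pnA _ _ _ _)).
  + by move/esym/eqP; rewrite (negPf (wN _ _ _ _)) ?pin.
  + by move/esym/eqP; rewrite (negPf (pnA _ _ _ _)).
  + have [_ _ ppx] := pD (inD _ xA); have [_ _ ppy] := pD (inD _ yA).
    by move=> /(congr1 p); rewrite ppx ppy.
- move=> x y xA yA; case: (gP x) => -[Px]; [move=> tx|move=> ntx|] => ->;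
    case: (gP y) => -[Py]; [move=> ty|move=> nty| |move=> ty|move=> nty|
      |move=> ty|move=> nty|] => ->.
  (* Adjacent private neighbours of two neighbours of [t] would close the pentagon [w x], [x], [t],
     [y], [w y]. *)
  + have [->|xy] := eqVneq x y; first by rewrite adj_irrefl.
    have tN z : z \in A -> t != z by move=> zA; rewrite eq_sym pnA.
    rewrite adj_sym; apply: (girth_no_pentagon g6 (b := x) (c := t) (d := y)) => //.
    * rewrite /= !inE !negb_or xy (eq_sym x (w y)) (eq_sym t (w y)) (eq_sym y (w y)).
      have [xD yD] := (inD _ xA, inD _ yA).
      rewrite !(wN x x, wN x t, wN x y, wN y x, wN y t, wN y y) // (eq_sym x t) !tN //=.
      rewrite !andbT.
      by apply: contraNneq xy => E; rewrite -(wadj y) ?inD // -E wadj ?inD.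
    * by rewrite wadj ?inD.
    * by rewrite adj_sym.
    * by rewrite adj_sym wadj ?inD.
  + exact: wx.
  + exact: wp.
  + by rewrite adj_sym wx.
  + exact: transversal_independent.
  + by rewrite adj_sym px.
  + by rewrite adj_sym wp.
  + exact: px.
  + apply/negP => /(ladj _ _ xA Px (pin _ yA))/esym/eqP.
    by apply/negP; apply: pnA.
- move=> x xA; case: (gP x) => -[Px]; [move=> _|move=> _|] => ->.
  + by rewrite eq_sym wN.
  + by rewrite eq_sym pnA.
  (* Equality of [t = p s] with [p x] would force [x = s], but [s] has a private neighbour and [x]
     has none. *)
  + apply: contraNneq Px => /(congr1 p); rewrite /t.
    by have [_ _ ->] := pD sD; have [_ _ ->] := pD (inD _ xA) => <-.
- move=> x xA; case: (gP x) => -[Px]; [move=> _|move=> ntx|] => -> //.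
  + by rewrite adj_sym wp.
  + rewrite adj_sym; apply/negP => /(ladj _ _ xA Px tD)/esym/eqP.
    by apply/negP; apply: pnA.
Qed.

(** No vertex of [A] has a private neighbour, so all partners are end vertices; and every edge of
    [G[D]] has an end outside the independent set [A]. *)
Lemma induced_matching x y : x \in D -> y \in D -> adj x y -> y = p x.
Proof.
have endA z u : z \in D -> z \notin A -> u \in D -> adj z u -> u = p z.
  move=> zD zA uD zu; have [_ _ ppz] := pD zD.
  have pzA : p z \in A by rewrite trA.
  have := QA pzA; rewrite /dispensable_partner (negPf (transversal_no_private pzA)) ppz.
  by move=> /andP[_ /forall_inP/(_ u uD)]; rewrite zu => /eqP.
move=> xD yD xy; case: (boolP (x \in A)) => xA; last exact: endA.
case: (boolP (y \in A)) => yA.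
  by have := transversal_independent xA yA; rewrite xy.
rewrite adj_sym in xy; have -> := endA _ _ yD yA xD xy.
by have [_ _ ->] := pD yD.
Qed.

(** For [y] outside [D], replacing the neighbours of [y] in [A] by their partners gives another
    transversal. It is independent because [G[D]] is an induced matching, and the absence of
    triangles keeps [y] nonadjacent to it. *)
Lemma minimal_paired_dominating_full : D = setT.
Proof.
apply/setP => y; rewrite inE; apply: contraT => yD.
have inD := subsetP AD.
pose g x := if adj y x then p x else x.
have gD x : x \in A -> g x \in D.
  by move=> /inD xD; have [? _ _] := pD xD; rewrite /g; case: ifP.
have pnA x z : x \in A -> z \in A -> (x == p z) = false.
  by move=> xA zA; apply: contraTF xA => /eqP->; apply: transversal_partner_notin.
have pinj x z : x \in A -> z \in A -> p x = p z -> x = z.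
  move=> /inD xA /inD zA; have [_ _ {2}<-] := pD xA; have [_ _ {2}<-] := pD zA.
  by move=> ->.
exfalso; apply: (@transversal_exchange g y).
- move=> x z xA zA; rewrite /g; case: ifP => _; case: ifP => _ //; last 1 first.
  + by move/eqP; rewrite pnA.
  + exact: pinj.
  + by move/esym/eqP; rewrite pnA.
- move=> x z xA zA; apply/negP => gxz.
  have E := induced_matching (gD _ xA) (gD _ zA) gxz.
  suff xz : x = z by move: gxz; rewrite xz adj_irrefl.
  move: E; rewrite /g; have [_ _ ppx] := pD (inD _ xA).
  case: ifP => _; case: ifP => _; rewrite ?ppx => /eqP.
  + by rewrite eq_sym pnA.
  + by move/eqP/pinj => ->.
  + by move/eqP->.
  + by rewrite pnA.
- by move=> x /gD; apply: contraTneq => <-.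
- move=> x xA; rewrite /g; case: ifP => [yx|-> //].
  by apply: girth_no_triangle yx _ => //; have [] := pD (inD _ xA).
Qed.

End MinimalPairedDominating.

(** * Disjoint unions of edges *)

Lemma pairing_isomorphic_mK2 (G : sgraph) (p : G -> G) (A : {set G}) : 0 < #|G| ->
  pairing setT p -> (forall x y, adj x y -> y = p x) ->
  (forall x, (p x \in A) = (x \notin A)) -> 0 < #|A| /\ isomorphic G (mK2 #|A|).
Proof.
move=> /card_gt0P[x0 _] pT onlyp trA.
have ppK x : p (p x) = x by have [] := pT x.
have adjE x y : adj x y = (y == p x).
  by apply/idP/eqP => [/onlyp //|->]; have [] := pT x.
have [a aA] : exists a, a \in A.
  by case: (boolP (x0 \in A)) => h; [exists x0 | exists (p x0); rewrite trA].
split; first by apply/card_gt0P; exists a.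
pose r x := if x \in A then x else p x.
have rA x : r x \in A by rewrite /r; case: ifPn => // h; rewrite trA.
(* Vertices of [A] index the copies of the edge; the boolean tells which end of the copy lies in
   [A]. *)
pose f x : mK2 #|A| := (enum_rank_in aA (r x), x \in A).
pose h (u : mK2 #|A|) := if u.2 then enum_val u.1 else p (enum_val u.1).
have fK : cancel f h.
  by move=> x; rewrite /h /f /= enum_rankK_in // /r; case: (x \in A).
exists f.
  exists h => // -[i b]; rewrite /f /h /r /=.
  have vA := enum_valP i; case: b; first by rewrite vA enum_valK_in.
  by rewrite trA vA ppK enum_valK_in.
move=> x y; rewrite adjE /= /mK2_adj /=.
apply/andP/eqP => [[/eqP/(congr1 enum_val)] | ->]; last first.
  by rewrite trA /r trA ppK; case: (x \in A); rewrite /= eqxx.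
rewrite !enum_rankK_in // /r; case: (x \in A); case: (y \in A) => //= E _.
by rewrite E ppK.
Qed.

Lemma mK2_pairing (G : sgraph) (m : nat) : isomorphic G (mK2 m) ->
  exists p : G -> G, (forall x, p (p x) = x) /\ (forall x y, adj x y = (y == p x)).
Proof.
case=> f [h fK hK] fadj; exists (fun x => h ((f x).1, ~~ (f x).2)); split.
  by move=> x; rewrite hK /= negbK -surjective_pairing fK.
move=> x y; rewrite -fadj -(inj_eq (can_inj fK)) hK /= /mK2_adj.
case: (f x) (f y) => [i b] [j c]; rewrite /= -pair_eqE /= eq_sym.
by case: b; case: c.
Qed.

(** A dominating set meets every edge. Hence only the whole vertex set is paired dominating, and a
    minimal dominating set takes exactly one end of each edge. *)
Lemma perfect_matching_graph_upper_domination (G : sgraph) (p : G -> G) :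
  (forall x, p (p x) = x) -> (forall x y, adj x y = (y == p x)) ->
  upper_paired_domination G = 2 * upper_domination G.
Proof.
move=> ppK adjE.
have pT : pairing [set: G] p by move=> x _; rewrite adjE eqxx inE.
have domP (D : {set G}) x : dominating D -> (x \in D) || (p x \in D).
  move/dominatingP=> dom; case: (boolP (x \in D)) => //= /dom[u uD].
  by rewrite adjE => /eqP ->; rewrite ppK.
have domI (D : {set G}) : (forall x, (x \in D) || (p x \in D)) -> dominating D.
  move=> h; apply/dominatingP => v vD; have := h v; rewrite (negPf vD) /= => pvD.
  by exists (p v); rewrite // adjE ppK.
have pairedT (D : {set G}) : paired_dominating D -> D = setT.
  move=> /paired_dominatingP[domD [q qD]]; apply/setP => x; rewrite inE.
  have /orP[//|/qD[qpD]] := domP _ x domD.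
  by rewrite adjE ppK => /eqP <-.
have pdT : paired_dominating [set: G].
  apply/paired_dominatingP; split; last by exists p.
  by apply: domI => x; rewrite inE.
have halfD (D : {set G}) : minset (@dominating G) D -> #|G| = 2 * #|D|.
  move=> minD; rewrite -cardsT; apply: pairing_card pT (subsetT D) _ => x _.
  have domD := minsetp minD; have := domP _ x domD.
  case: (boolP (x \in D)) => //= xD _; apply: contraTF (xD) => pxD.
  suff <- : D :\ x = D by rewrite setD11.
  apply: minsetinf minD _ (subsetDl _ _); apply: domI => y; rewrite !inE.
  have [->|yx] /= := eqVneq y x.
    by rewrite pxD andbT eq_sym adj_neq // adjE.
  have [E|] := eqVneq (p y) x; last by move=> _; apply: domP.
  by rewrite -(ppK y) E pxD.
have [D0 minD0 _] := minset_exists pdT.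
have domT : dominating [set: G] by have /andP[] := pdT.
have [D1 minD1 _] := minset_exists domT.
have -> : upper_paired_domination G = #|G|.
  apply/eqP; rewrite eqn_leq; apply/andP; split.
    by apply/bigmax_leqP => D _; apply: max_card.
  by rewrite -cardsT -(pairedT D0) ?leq_bigmax_cond ?(minsetp minD0).
rewrite (halfD _ minD1); congr (2 * _); apply/eqP; rewrite eqn_leq; apply/andP; split.
  exact: leq_bigmax_cond.
apply/bigmax_leqP => D /halfD; rewrite (halfD _ minD1) => /eqP.
by rewrite eqn_mul2l /= => /eqP ->.
Qed.

Theorem theorem12 (G : sgraph) (Gnonempty : 0 < #|G|)
    (Ggirth : girth_at_least G 6) :
  upper_paired_domination G = 2 * upper_domination G <->
  exists m : nat, 1 <= m /\ isomorphic G (mK2 m).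
Proof.
split=> [EG|[m [_ /mK2_pairing[p [ppK adjE]]]]]; last first.
  exact: perfect_matching_graph_upper_domination ppK adjE.
(* Positivity ensures that a minimal paired dominating set exists: over an empty family the maximum
   would be the default 0. *)
have gamma_gt0 : 0 < upper_domination G.
  have /card_gt0P[x _] := Gnonempty.
  rewrite -(cards1 x); apply: leq_independent_upper_domination.
  by move=> u v /set1P -> /set1P ->; rewrite adj_irrefl.
have [D minD cD] : exists2 D : {set G}, minset (@paired_dominating G) D
    & #|D| = 2 * upper_domination G.
  case: (pickP (minset (@paired_dominating G))) => [D0 minD0 | no].
    have [|D minD] := @eq_bigmax_cond _ (minset (@paired_dominating G)) (fun D => #|D|).
      by apply/card_gt0P; exists D0.
    by exists D; rewrite // -EG.
  by move: EG; rewrite /upper_paired_domination big_pred0 //; lia.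
have /paired_dominatingP[_ [p pD]] := minsetp minD.
have [A [AD trA QA]] := pairing_transversal pD (dispensable_partner_pair Ggirth minD pD).
have DT := minimal_paired_dominating_full Ggirth minD pD cD AD trA QA.
have onlyp := induced_matching Ggirth minD pD cD AD trA QA.
subst D; exists #|A|; apply: (@pairing_isomorphic_mK2 G p A) => // x.
  by move=> y; apply: onlyp; rewrite inE.
by rewrite trA ?inE.
Qed.
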